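(* Let $n\ge1$, $d\ge1$ and let $w$ be a word consisting of $n$ letters $U$, $n$ letters $D$ and $d$ letters $H$. Then $w\in\mathsf{Schr\ddot{o}der}_{n,d}$ if and only if $\mathsf{sts}_{n,d}(w)\in\mathsf{Sawtooth}_{n+1,d}$.
   Context: $\mathsf{Schr\ddot{o}der}_{n,d}$ is the set of words with $n$ $U$'s, $n$ $D$'s and $d$ $H$'s such that every prefix contains at most as many $D$'s as $U$'s. Steps: $\mathsf{s}=(0,-1)$, $\mathsf{w}=(-1,0)$, $\mathsf{n}=(0,1)$, $\mathsf{e}=(1,0)$, $\mathsf{nw}=(-1,1)$, $\mathsf{se}=(1,-1)$. For positive integers $N,d$, $\mathsf{Sawtooth}_{N,d}$ is the set of pairs of lattice paths (Upper, Lower) from $(0,0)$ to $(N,d)$ such that Upper uses steps in $\{\mathsf{n},\mathsf{se}\}$, Lower uses steps in $\{\mathsf{e},\mathsf{n}\}$, and the two paths meet only at $(0,0)$ and $(N,d)$ (paths are regarded as point sets, so their orientation is immaterial). For $w=w_1\cdots w_{2n+d}$, $\mathsf{sts}_{n,d}(w)=(\mathsf{Upper}(w),\mathsf{Lower}(w))$ is constructed as follows. Upper path: draw an $\mathsf{nw}$ step from $(n+1,d)$ to $(n,d+1)$; then read $w$ from left to right, drawing an $\mathsf{nw}$ step for each $U$ and an $\mathsf{s}$ step for each non-$U$ letter; finally draw one more $\mathsf{s}$ step, ending at $(0,0)$. Lower path: starting at $(n+1,d)$, read $w$ from left to right, drawing an $\mathsf{s}$ step for each $H$ and a $\mathsf{w}$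 step for each $D$ (and nothing for $U$); finally join the end point $(1,0)$ to $(0,0)$. *)

(* Defs.v *)
From HB Require Import structures.
From mathcomp Require Import all_boot all_order all_algebra.
From mathcomp Require Import boolp classical_sets reals.

Set Implicit Arguments.
Unset Strict Implicit.
Unset Printing Implicit Defensive.

Import Order.TTheory GRing.Theory Num.Theory.
Local Open Scope classical_set_scope.
Local Open Scope ring_scope.

Inductive letter := letU | letD | letH.

Definition letter_code (a : letter) : option bool :=
  match a with letU => Some true | letD => Some false | letH => None end.
Definition letter_decode (o : option bool) : letter :=
  match o with Some true => letU | Some false => letD | None => letH end.
Lemma letter_codeK : cancel letter_code letter_decode.
Proof. by case. Qed.
HB.instance Definition _ := Equality.copy letter (can_type letter_codeK).

Definition is_word (n d : nat) (w : seq letter) : Prop :=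
  [/\ count_mem letU w = n, count_mem letD w = n & count_mem letH w = d].

Definition Schroder (n d : nat) : set (seq letter) :=
  [set w | is_word n d w /\
     forall p : seq letter, prefix p w ->
       (count_mem letD p <= count_mem letU p)%N].

Definition step_s  : int * int := (0, -1).
Definition step_w  : int * int := (-1, 0).
Definition step_n  : int * int := (0, 1).
Definition step_e  : int * int := (1, 0).
Definition step_nw : int * int := (-1, 1).
Definition step_se : int * int := (1, -1).

(* A lattice path is given by its starting point [p] and the sequence [s] of
   its subsequent vertices. *)
Definition is_lattice_path (S : seq (int * int)) (p q : int * int)
    (s : seq (int * int)) : bool :=
  path (fun a b => b - a \in S) p s && (last p s == q).

Definition draw (p : int * int) (steps : seq (int * int)) : seq (int * int) :=
  scanl (fun a v => a + v) p steps.

Section PointSets.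
Variable R : realType.

Definition plane_pt (p : int * int) : R * R := (p.1%:~R, p.2%:~R).

Definition segment (p q : R * R) : set (R * R) :=
  [set z | exists2 t : R, 0 <= t <= 1 &
     z = ((1 - t) * p.1 + t * q.1, (1 - t) * p.2 + t * q.2)].

(* The polygonal curve in the plane R^2 through [p] and then the vertices [s]:
   as a point set it does not remember the direction of travel. *)
Fixpoint trace (p : int * int) (s : seq (int * int)) : set (R * R) :=
  if s is q :: s' then segment (plane_pt p) (plane_pt q) `|` trace q s'
  else [set plane_pt p].

Definition Sawtooth (N d : nat) : set (set (R * R) * set (R * R)) :=
  [set P |
    [/\ exists2 s, is_lattice_path [:: step_n; step_se] (0, 0) (N%:Z, d%:Z) s
                 & P.1 = trace (0, 0) s,
        exists2 s, is_lattice_path [:: step_e; step_n] (0, 0) (N%:Z, d%:Z) s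
                 & P.2 = trace (0, 0) s
      & P.1 `&` P.2 = [set plane_pt (0, 0); plane_pt (N%:Z, d%:Z)]]].

Definition upper_step (a : letter) : int * int :=
  if a is letU then step_nw else step_s.

Definition Upper (n d : nat) (w : seq letter) : set (R * R) :=
  let p : int * int := (n.+1%:Z, d%:Z) in
  trace p (draw p (step_nw :: rcons (map upper_step w) step_s)).

Definition lower_step (a : letter) : option (int * int) :=
  match a with
  | letU => None
  | letD => Some step_w
  | letH => Some step_s
  end.

Definition Lower (n d : nat) (w : seq letter) : set (R * R) :=
  let p : int * int := (n.+1%:Z, d%:Z) in
  trace p (rcons (draw p (pmap lower_step w)) (0, 0)).

Definition sts (n d : nat) (w : seq letter) : set (R * R) * set (R * R) :=
  (Upper n d w, Lower n d w).

End PointSets.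

Arguments Sawtooth : clear implicits.
Arguments sts : clear implicits.

(* Main.v *)
Require Import Defs.
From mathcomp Require Import all_boot all_order all_algebra.
From mathcomp Require Import boolp classical_sets reals.
From mathcomp Require Import zify ring lra.

Set Implicit Arguments.
Unset Strict Implicit.
Unset Printing Implicit Defensive.

Import Order.TTheory GRing.Theory Num.Theory.
Local Open Scope classical_set_scope.
Local Open Scope ring_scope.

(** After reading a prefix of [w] with [u] letters U, [a] letters D and [h]
    letters H, the upper path is at [(n - u, d + 1 + u - a - h)] and the lower
    path at [(n + 1 - a, d - h)].  These points lie on the same antidiagonal,
    and the first is obtained from the second by [u - a + 1] steps nw.  So the
    Schröder condition says that the upper path stays strictly north-west of
    the lower one, antidiagonal by antidiagonal; if it fails, then at the first
    violation [u - a + 1 = 0] and the two paths share a vertex which is neither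
    of the end points. *)

(** * Drawn vertex sequences and their reversal *)

Lemma last_draw p vs : last p (draw p vs) = p + \sum_(v <- vs) v.
Proof.
elim: vs p => [|v vs IH] p /=; first by rewrite big_nil addr0.
by rewrite IH big_cons addrA.
Qed.

Lemma draw_rcons p vs v :
  draw p (rcons vs v) = rcons (draw p vs) (p + \sum_(u <- vs) u + v).
Proof.
elim: vs p => [|u vs IH] p /=; first by rewrite big_nil addr0.
by rewrite IH big_cons addrA.
Qed.

Lemma path_draw (S : seq (int * int)) p vs :
  all (mem S) vs -> path (fun a b => b - a \in S) p (draw p vs).
Proof.
elim: vs p => [//|v vs IH] p /= /andP[vS /IH ->].
by rewrite addrAC subrr add0r vS.
Qed.

(** [sts] draws towards the origin, while [Sawtooth] wants paths issuing from it; walking backwards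
    turns each step [v] into [- v]. *)
Lemma is_lattice_path_rev (S : seq (int * int)) p vs :
  all (fun v => - v \in S) vs -> p + \sum_(v <- vs) v = 0 ->
  is_lattice_path S (0, 0) p (rev (belast p (draw p vs))).
Proof.
move=> vsS; rewrite -last_draw => end0; apply/andP; split; last first.
  case: vs {vsS} end0 => [/eqP|v vs _]; first by rewrite eq_sym.
  by rewrite /draw /= rev_cons last_rcons.
have -> : (0, 0) = last p (draw p vs) by rewrite end0.
rewrite rev_path; apply: sub_path (path_draw (S := map -%R S) _ _).
  by move=> x y /mapP[v vS xy]; rewrite /= -opprB xy opprK.
apply: sub_all vsS => v vS; apply/mapP; exists (- v) => //.
by rewrite opprK.
Qed.

(** * Point sets of paths, and the antidiagonals they cross *)

Section Traces.
Variable R : realType.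
Implicit Types (p v : int * int) (vs : seq (int * int)) (z : R * R).

Lemma segmentC (a b : R * R) : segment a b = segment b a.
Proof.
suff sub x y : segment x y `<=` segment (R := R) y x by apply/seteqP; split.
move=> z [t /andP[t0 t1] ->]; exists (1 - t); first by apply/andP; split; lra.
by congr pair; ring.
Qed.

Lemma segment_l (a b : R * R) : segment a b a.
Proof.
exists 0; first by rewrite lexx ler01.
by case: a => a1 a2 /=; congr pair; ring.
Qed.

Lemma trace_start p vs : trace p vs (plane_pt R p).
Proof. by case: vs => [//|v vs]; left; apply: segment_l. Qed.

Lemma trace_rcons p vs q :
  trace p (rcons vs q) =
  trace p vs `|` segment (plane_pt R (last p vs)) (plane_pt R q).
Proof.
elim: vs p => [|v vs IH] p /=; last by rewrite IH setUA.
apply/seteqP; split => z.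
  case=> [pq|->]; first by right.
  by right; rewrite segmentC; apply: segment_l.
by case=> [->|pq]; left => //; apply: segment_l.
Qed.

Lemma trace_rev p vs :
  trace (last p vs) (rev (belast p vs)) = trace (R := R) p vs.
Proof.
elim: vs p => [//|v vs IH] p /=.
rewrite rev_cons trace_rcons IH.
have -> : last (last v vs) (rev (belast v vs)) = v.
  by case: vs {IH} => [//|u vs] /=; rewrite rev_cons last_rcons.
by rewrite setUC segmentC.
Qed.

Lemma trace_mem p vs q : q \in p :: vs -> trace p vs (plane_pt R q).
Proof.
elim: vs p => [|v vs IH] p; first by rewrite inE => /eqP ->.
rewrite inE => /predU1P[->|/IH]; first exact: trace_start.
by right.
Qed.

Lemma segment_stepP p v z : segment (plane_pt R p) (plane_pt R (p + v)) z ->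
  exists2 t : R, 0 <= t <= 1 &
    z = (p.1%:~R + t * v.1%:~R, p.2%:~R + t * v.2%:~R).
Proof.
by case=> t t01 ->; exists t => //=; congr pair; rewrite intrD; ring.
Qed.

(** No step raises the coordinate sum, so the path never climbs above its first antidiagonal. *)
Lemma trace_antidiag_le p vs z : all (fun v => v.1 + v.2 <= 0) vs ->
  trace p (draw p vs) z -> z.1 + z.2 <= (p.1 + p.2)%:~R.
Proof.
elim: vs p => [|v vs IH] p /=; first by move=> _ -> /=; rewrite intrD.
move=> /andP[v0 vs0]; have := v0; rewrite -(lerz0 R) intrD => v0R.
case=> [/segment_stepP[t /andP[t0 t1] ->]|/(IH _ vs0)] /=; rewrite !intrD.
  by nra.
by lra.
Qed.

(** With strictly descending steps the path leaves its first antidiagonal for good as soon as it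
    moves. *)
Lemma trace_antidiag_eq p vs z : all (fun v => v.1 + v.2 < 0) vs ->
  trace p (draw p vs) z -> z.1 + z.2 = (p.1 + p.2)%:~R -> z = plane_pt R p.
Proof.
case: vs => [|v vs] //= /andP[v0 vs0].
move: v0; rewrite -(ltrz0 R) intrD => v0R.
case=> [/segment_stepP[t /andP[t0 t1] ->]|zT] /=; rewrite !intrD => zp.
  have -> : t = 0.
    have : t * (v.1%:~R + v.2%:~R) = 0 by lra.
    by move=> /eqP; rewrite mulf_eq0 => /orP[/eqP|/eqP] //; lra.
  by rewrite !mul0r !addr0.
have vs0' : all (fun v => v.1 + v.2 <= 0) vs.
  by apply: sub_all vs0 => u /ltW.
by have := trace_antidiag_le vs0' zT; rewrite /= !intrD => le1; exfalso; lra.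
Qed.

(** Lets an induction peel one step off both paths at once. Both first steps drop by exactly one
    antidiagonal and the tails stay on or below the next one; so a point of one first segment that
    lies on the other tail is the far end of that segment, where its own tail starts. *)
Lemma common_point_descent p q u v us vs z :
  p.1 + p.2 = q.1 + q.2 -> u.1 + u.2 = -1 -> v.1 + v.2 = -1 ->
  all (fun v => v.1 + v.2 <= 0) us -> all (fun v => v.1 + v.2 <= 0) vs ->
  trace p (draw p (u :: us)) z -> trace q (draw q (v :: vs)) z ->
  (segment (plane_pt R p) (plane_pt R (p + u)) `&`
   segment (plane_pt R q) (plane_pt R (q + v))) z \/
  (trace (p + u) (draw (p + u) us) `&` trace (q + v) (draw (q + v) vs)) z.
Proof.
move=> /(congr1 (fun i : int => i%:~R : R)) pq.
move=> /(congr1 (fun i : int => i%:~R : R)) u1.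
move=> /(congr1 (fun i : int => i%:~R : R)) v1 us0 vs0.
rewrite !intrD in pq u1 v1.
have segend x y : (y.1%:~R + y.2%:~R = -1 :> R) ->
    segment (plane_pt R x) (plane_pt R (x + y)) z ->
    z.1 + z.2 <= x.1%:~R + x.2%:~R - 1 -> z = plane_pt R (x + y).
  move=> y1 /segment_stepP[t /andP[t0 t1] ->] /= le1.
  have ty : t * y.1%:~R + t * y.2%:~R = - t by rewrite -mulrDr y1 mulrN1.
  have -> : t = 1 by lra.
  by rewrite !mul1r /plane_pt /= !intrD.
case=> [zp|zp] [zq|zq]; [by left| | |by right]; right; split=> //.
- have := trace_antidiag_le vs0 zq; rewrite /= !intrD => le1.
  rewrite (segend _ _ u1 zp); first exact: trace_start.
  by lra.
- have := trace_antidiag_le us0 zp; rewrite /= !intrD => le1.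
  rewrite (segend _ _ v1 zq); first exact: trace_start.
  by lra.
Qed.

(** The opening [step_nw] of [Upper] is left out: it creates the initial gap of one step nw between
    the two paths. *)
Definition upper_steps (w : seq letter) := rcons (map upper_step w) step_s.

Definition lower_steps (w : seq letter) := rcons (pmap lower_step w) step_w.

Lemma upper_steps_le0 w : all (fun v => v.1 + v.2 <= 0) (upper_steps w).
Proof. by rewrite all_rcons /=; elim: w => [//|[] w]. Qed.

Lemma lower_steps_lt0 w : all (fun v => v.1 + v.2 < 0) (lower_steps w).
Proof. by rewrite all_rcons /=; elim: w => [//|[] w]. Qed.

Lemma lower_steps_le0 w : all (fun v => v.1 + v.2 <= 0) (lower_steps w).
Proof. by apply: sub_all (lower_steps_lt0 w) => v /ltW. Qed.

(* [k] is the number of steps nw leading from the current point of the lower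
   path to that of the upper path. *)
Lemma upper_lower_meet w p (k : nat) z :
  (forall s, prefix s w -> (count_mem letD s < k + count_mem letU s)%N) ->
  (k + count_mem letU w = (count_mem letD w).+1)%N ->
  p + \sum_(v <- upper_steps w) v = 0 ->
  trace p (draw p (upper_steps w)) z ->
  trace (p + (k%:Z, - k%:Z)) (draw (p + (k%:Z, - k%:Z)) (lower_steps w)) z ->
  z = plane_pt R (0, 0).
Proof.
elim: w p k => [|x w IH] p k kpos kend pend.
  (* Empty word: what remains is [step_s] from (0, 1) and [step_w] from (1, 0), which lie on the two
     axes and meet at the origin only. *)
  have -> : k = 1%N by rewrite /= in kend; lia.
  move: pend; rewrite /upper_steps /lower_steps /= big_seq1 => pend.
  have {pend} -> : p = (0, 1) by rewrite -[p](addrK step_s) pend.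
  move=> zu zl.
  have [] := common_point_descent (p := (0, 1)) (q := (0, 1) + (1, -1))
    (u := step_s) (v := step_w) (us := [::]) (vs := [::])
    erefl erefl erefl isT isT zu zl.
    case=> /segment_stepP[t _ ->] /segment_stepP[t' _ /=] [e1 e2].
    by congr pair; move: e1 e2; rewrite /=; lra.
  by case=> ->.
have kposx s : prefix s w ->
    (count_mem letD (x :: s) < k + count_mem letU (x :: s))%N.
  by move=> sw; apply: kpos; rewrite /= eqxx.
have k0 := kpos [::] (prefix0s _); rewrite /= addn0 in k0.
have pendx : (p + upper_step x) + \sum_(v <- upper_steps w) v = 0.
  by rewrite -addrA -[RHS]pend /upper_steps /= big_cons.
have kR : 0 < k%:Z%:~R :> R by rewrite ltr0z.
have pkE : p.1 + p.2 = (p + (k%:Z, - k%:Z)).1 + (p + (k%:Z, - k%:Z)).2.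
  by rewrite /=; ring.
case: x kpos kend kposx pend pendx => kpos kend kposx pend pendx zu zl.
(* Letter U: only the upper path moves, inside the common antidiagonal. There the lower path has
   just its current point, whose abscissa exceeds those of the nw segment. The gap grows to
   [k.+1]. *)
- case: zu => [/segment_stepP[t t01 zE]|zu].
    have zsum : z.1 + z.2 =
        ((p + (k%:Z, - k%:Z)).1 + (p + (k%:Z, - k%:Z)).2)%:~R.
      by rewrite -pkE zE /= intrD; ring.
    have := congr1 fst (trace_antidiag_eq (lower_steps_lt0 w) zl zsum).
    by rewrite zE /= intrD => e; exfalso; lra.
  apply: (IH _ k.+1 _ _ pendx zu).
  + by move=> s /kposx /=; lia.
  + by move: kend => /=; lia.
  + suff -> : p + step_nw + (k.+1%:Z, - k.+1%:Z) = p + (k%:Z, - k%:Z) by [].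
    by rewrite -addrA; congr (p + _); congr pair; rewrite /=; lia.
(* Letter D: the one-letter prefix forces a gap of at least 2, so the w segment stays strictly to
   the right of the s segment. *)
- have k1 : (1 < k)%N by have := kposx [::] (prefix0s _); rewrite /=; lia.
  have kR1 : 1 < k%:Z%:~R :> R by rewrite ltr1z.
  have [] := common_point_descent (u := step_s) (v := step_w) pkE
    erefl erefl (upper_steps_le0 w) (lower_steps_le0 w) zu zl.
    case=> /segment_stepP[t _ ->] /segment_stepP[t' t01 /=] [+ _].
    by rewrite intrD => e; exfalso; lra.
  case=> zu' zl'; apply: (IH _ k.-1 _ _ pendx zu').
  + by move=> s /kposx /=; lia.
  + by move: kend => /=; lia.
  + suff -> : p + step_s + (k.-1%:Z, - k.-1%:Z) =
        p + (k%:Z, - k%:Z) + step_w by [].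
    by rewrite -!addrA; congr (p + _); congr pair; rewrite /=; lia.
(* Letter H: two vertical segments at horizontal distance [k], which is positive. *)
- have [] := common_point_descent (u := step_s) (v := step_s) pkE
    erefl erefl (upper_steps_le0 w) (lower_steps_le0 w) zu zl.
    case=> /segment_stepP[t _ ->] /segment_stepP[t' t01 /=] [+ _].
    by rewrite intrD => e; exfalso; lra.
  case=> zu' zl'; apply: (IH _ k _ _ pendx zu').
  + by move=> s /kposx /=; lia.
  + by move: kend => /=; lia.
  + by rewrite addrAC.
Qed.

End Traces.

(** * Displacements in terms of letter counts *)

Lemma sum_upper_step w : \sum_(a <- w) upper_step a =
  (- (count_mem letU w)%:Z,
   (count_mem letU w)%:Z - (count_mem letD w)%:Z - (count_mem letH w)%:Z).
Proof.
elim: w => [|a w IH]; first by rewrite big_nil.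
by rewrite big_cons IH; case: a => /=; congr pair; rewrite /=; lia.
Qed.

Lemma sum_lower_step w : \sum_(v <- pmap lower_step w) v =
  (- (count_mem letD w)%:Z, - (count_mem letH w)%:Z).
Proof.
elim: w => [|a w IH]; first by rewrite big_nil.
by case: a => /=; rewrite ?big_cons IH //; congr pair; rewrite /=; lia.
Qed.

Lemma sum_upper_steps w : \sum_(v <- upper_steps w) v =
  (- (count_mem letU w)%:Z,
   (count_mem letU w)%:Z - (count_mem letD w)%:Z - (count_mem letH w).+1%:Z).
Proof.
rewrite /upper_steps -cats1 big_cat big_seq1 big_map sum_upper_step.
by congr pair; rewrite /=; lia.
Qed.

Lemma draw_mem p s t : p + \sum_(v <- s) v \in p :: draw p (s ++ t).
Proof.
elim: s p => [|v s IH] p; first by rewrite big_nil addr0 mem_head.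
by rewrite big_cons addrA inE IH orbT.
Qed.

Lemma UpperE (R : realType) n d w : Upper n d w =
  trace (R := R) (n.+1%:Z, d%:Z)
    (draw (n.+1%:Z, d%:Z) (step_nw :: upper_steps w)).
Proof. by []. Qed.

(** The letter counts put the last vertex before the join at (1, 0), so the closing segment is a
    [step_w]. *)
Lemma LowerE (R : realType) n d w : is_word n d w -> Lower n d w =
  trace (R := R) (n.+1%:Z, d%:Z) (draw (n.+1%:Z, d%:Z) (lower_steps w)).
Proof.
case=> [_ cD cH]; rewrite /Lower /lower_steps draw_rcons sum_lower_step cD cH.
by congr (trace _ (rcons _ _)); congr pair; rewrite /=; lia.
Qed.

Theorem theorem4p5 (R : realType) (n d : nat) (w : seq letter)
    (hn : (1 <= n)%N) (hd : (1 <= d)%N) (hw : is_word n d w) :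
  Schroder n d w <-> Sawtooth R n.+1 d (sts R n d w).
Proof.
have [cU cD cH] := hw.
set o : int * int := (n.+1%:Z, d%:Z).
have upper_end : o + \sum_(v <- step_nw :: upper_steps w) v = 0.
  rewrite big_cons sum_upper_steps cU cD cH.
  by congr pair; rewrite /=; lia.
have lower_end : o + \sum_(v <- lower_steps w) v = 0.
  rewrite /lower_steps -cats1 big_cat big_seq1 sum_lower_step cD cH.
  by congr pair; rewrite /=; lia.
split=> [[_ schw]|[_ _ meet]].
- split.
  + exists (rev (belast o (draw o (step_nw :: upper_steps w)))).
      apply: is_lattice_path_rev => //.
      by rewrite /= all_rcons /=; elim: (w) => [//|[] w'].
    have := trace_rev R o (draw o (step_nw :: upper_steps w)).
    by rewrite last_draw upper_end => ->.
  + exists (rev (belast o (draw o (lower_steps w)))).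
      apply: is_lattice_path_rev => //.
      by rewrite /= all_rcons /=; elim: (w) => [//|[] w'].
    have := trace_rev R o (draw o (lower_steps w)).
    by rewrite last_draw lower_end => ->; apply: LowerE.
  rewrite /sts /= UpperE (LowerE R hw) -/o.
  apply/seteqP; split=> [z [zu zl]|z].
    (* After the opening nw step the gap is [k = 1]. *)
    have op : o = o + step_nw + (1%:Z, - 1%:Z).
      by congr pair; rewrite /=; lia.
    (* The opening nw segment lies in the antidiagonal of [o], which the lower path touches only at
       [o]. *)
    case: zu => [/segment_stepP[t t01 zE]|zu].
      right; apply: (trace_antidiag_eq (lower_steps_lt0 _) zl).
      by rewrite zE /= intrD; ring.
    left; rewrite [X in trace X (draw X _)]op in zl.
    apply: (upper_lower_meet _ _ _ zu zl).
    * by move=> s /schw; rewrite add1n ltnS.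
    * by rewrite cU cD.
    * by rewrite -[RHS]upper_end big_cons addrA.
  case=> ->; last by split; apply: trace_start.
  have o0 : plane_pt R (0, 0) = plane_pt R 0 by [].
  rewrite o0; split.
    by rewrite -[in plane_pt _ 0]upper_end -last_draw; apply/trace_mem/mem_last.
  by rewrite -[in plane_pt _ 0]lower_end -last_draw; apply/trace_mem/mem_last.
(* Induction from the right makes [rcons s a] the first violation, so the D's exceed the U's by
   exactly one. *)
split=> // s; elim/last_ind: s => [//|s a IH] sw.
have /IH sle : prefix s w by apply: prefix_trans sw; apply: prefix_rcons.
rewrite leqNgt; apply/negP => lt; have [t wE] := prefixP sw.
have Ds : count_mem letD (rcons s a) = (count_mem letU (rcons s a)).+1.
  by move: lt sle; rewrite -cats1 !count_cat; case: (a) => /=; lia.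
(* The vertex that the lower path, and by [qE] also the upper path, reaches after this prefix. *)
set q := o + \sum_(v <- pmap lower_step (rcons s a)) v.
have qE : q = o + \sum_(v <- step_nw :: map upper_step (rcons s a)) v.
  rewrite /q big_cons big_map sum_lower_step sum_upper_step Ds.
  by congr pair; rewrite /=; lia.
have : ((sts R n d w).1 `&` (sts R n d w).2) (plane_pt R q).
  rewrite /sts /= UpperE (LowerE R hw) -/o; split; apply: trace_mem.
    by rewrite qE /upper_steps wE map_cat rcons_cat -cat_cons draw_mem.
  by rewrite /lower_steps wE pmap_cat rcons_cat draw_mem.
(* The prefix has between 1 and [n] letters D, so the abscissa of [q] lies between 1 and [n]: it is
   neither 0 nor [n.+1]. *)
have : (count_mem letD (rcons s a) <= n)%N by rewrite -cD wE count_cat leq_addr.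
rewrite meet /q sum_lower_step Ds => le_n.
move: (count_mem letU (rcons s a)) le_n => c le_n.
by case=> -[] /intr_inj + _; clear -le_n; rewrite /=; lia.
Qed.
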